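(* Every invertible hyperbolic operator on a locally convex space (over $\mathbb{R}$ or $\mathbb{C}$) is uniformly topologically expansive.
   Context: All topological vector spaces are Hausdorff. $\mathbb{N}_0=\{0,1,2,\dots\}$. ''Invertible operator'' means a continuous linear operator on $X$ with a continuous inverse. Let the topology of the locally convex space $X$ be induced by a family $(\|\cdot\|_\alpha)_{\alpha\in I}$ of seminorms that is directed (for all $\alpha,\beta\in I$ there is $\gamma\in I$ with $\|\cdot\|_\alpha\le\|\cdot\|_\gamma$ and $\|\cdot\|_\beta\le\|\cdot\|_\gamma$); the notions below do not depend on the choice of this family. An invertible $T$ is hyperbolic if there is a topological direct sum decomposition $X=M\oplus N$ (algebraic direct sum with $(y,z)\mapsto y+z$ a homeomorphism $M\times N\to X$) such that $T(M)\subset M$, $T(N)\subset N$, $T^{-1}(N)\subset N$, and for every $\alpha\in I$ there exist $\beta\in I$, $c>0$, $t\in(0,1)$ with $\|T^ny\|_\alpha\le c\,t^n\|y\|_\beta$ and $\|T^{-n}z\|_\alpha\le c\,t^n\|z\|_\beta$ for all $y\in M$, $z\in N$, $n\in\mathbb{N}_0$. $T$ is uniformly topologically expansive if for every $\alpha\in I$ there exists $\beta\in I$ such that one can write $\{x\in X:\|x\|_\alpha=1\}=A_\alpha\cup B_\alpha$, where $\|T^nx\|_\beta\to\infty$ uniformly on $A_\alpha$ as $n\to\infty$ and $\|T^{-n}x\|_\beta\to\infty$ uniformly on $B_\alpha$ as $n\to\infty$. *)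

(* Defs.v *)
From HB Require Import structures.
From mathcomp Require Import all_boot all_order all_algebra.
From mathcomp Require Import complex.
From mathcomp Require Import boolp classical_sets functions reals topology.
From mathcomp Require Import normedtype.

Set Implicit Arguments.
Unset Strict Implicit.
Unset Printing Implicit Defensive.

Import Order.TTheory GRing.Theory Num.Theory.
Import numFieldNormedType.Exports.

Local Open Scope classical_set_scope.
Local Open Scope ring_scope.

Variant scalar_kind := RealScalars | ComplexScalars.

Definition scalars (R : realType) (k : scalar_kind) : numFieldType :=
  match k with
  | RealScalars => R
  | ComplexScalars => R[i]
  end.

(* The absolute value of a scalar as an element of R; the norm of R[i] takes
   its values in R[i], whereas seminorms are real-valued. *)
Definition modulus (R : realType) (k : scalar_kind) : scalars R k -> R :=
  match k return scalars R k -> R with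
  | RealScalars => fun a : R => `|a|
  | ComplexScalars => fun a : R[i] => Normc.normc a
  end.

Section SeminormFamilies.
Variables (R : realType) (k : scalar_kind) (X : tvsType (scalars R k)).

Definition is_seminorm (p : X -> R) : Prop :=
  [/\ forall x, 0 <= p x,
      forall x y, p (x + y) <= p x + p y
    & forall a x, p (a *: x) = modulus a * p x].

Variables (I : Type) (p : I -> X -> R).

Definition directed_family : Prop :=
  forall i j, exists l, (forall x, p i x <= p l x) /\ (forall x, p j x <= p l x).

(* The neighbourhoods of x are the supersets of finite intersections of
   seminorm balls centred at x. *)
Definition induces_topology : Prop :=
  forall (x : X) (U : set X), nbhs x U <->
    exists (n : nat) (s : 'I_n -> I) (e : R),
      0 < e /\ [set y | forall m, p (s m) (y - x) < e] `<=` U.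

End SeminormFamilies.

Section Operators.
Variables (R : realType) (k : scalar_kind) (X : tvsType (scalars R k)).

Definition invertible_operator (T : {linear X -> X}) (Tinv : X -> X) : Prop :=
  [/\ continuous T, continuous Tinv, cancel T Tinv & cancel Tinv T].

(* M and N, coerced to types, carry the topology induced by X; bijectivity of
   the sum map is the algebraic direct sum decomposition. *)
Definition topological_direct_sum (M N : set X) : Prop :=
  [/\ GRing.submod_closed [in M], GRing.submod_closed [in N] &
      exists g : X -> (M * N)%type,
        let f := fun yz : (M * N)%type => val yz.1 + val yz.2 in
        [/\ cancel f g, cancel g f, continuous f & continuous g]].

Variables (I : Type) (p : I -> X -> R).

Definition hyperbolic (T Tinv : X -> X) : Prop :=
  exists M N : set X,
    [/\ topological_direct_sum M N,
        T @` M `<=` M, T @` N `<=` N, Tinv @` N `<=` N &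
        forall i, exists (j : I) (c t : R),
          [/\ 0 < c, 0 < t, t < 1,
              forall y (n : nat), M y ->
                p i (iter n T y) <= c * t ^+ n * p j y
            & forall z (n : nat), N z ->
                p i (iter n Tinv z) <= c * t ^+ n * p j z]].

Definition diverges_uniformly_on (f : nat -> X -> R) (A : set X) : Prop :=
  forall C : R, \forall n \near \oo, forall x, A x -> C <= f n x.

Definition uniformly_topologically_expansive (T Tinv : X -> X) : Prop :=
  forall i, exists (j : I) (A B : set X),
    [/\ [set x | p i x = 1] = A `|` B,
        diverges_uniformly_on (fun n x => p j (iter n T x)) A
      & diverges_uniformly_on (fun n x => p j (iter n Tinv x)) B].

End Operators.

(* Main.v *)
(** T preserves both summands of X = M (+) N, so it commutes with the two
projections, and therefore so does T^-1. If p_i x = 1, one of the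
components of x has p_i-size at least 1/2.  If it is the N-component z, then
1/2 <= p_i (T^-n (T^n z)) <= c t^n p_j (T^n z), and T^n z is the projection of
T^n x, so continuity of the projection bounds p_j (T^n z) by a multiple of
p_l (T^n x), which must therefore tend to infinity.  The other case is symmetric. *)
Require Import Defs.
From HB Require Import structures.
From mathcomp Require Import all_boot all_order all_algebra.
From mathcomp Require Import complex.
From mathcomp Require Import boolp classical_sets functions reals topology.
From mathcomp Require Import normedtype sequences.
From mathcomp Require Import lra.

Set Implicit Arguments.
Unset Strict Implicit.
Unset Printing Implicit Defensive.

Import Order.TTheory GRing.Theory Num.Theory.
Import numFieldNormedType.Exports.

Local Open Scope classical_set_scope.
Local Open Scope ring_scope.

Lemma modulus_nneg_surj (R : realType) (k : scalar_kind) (r : R) :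
  0 <= r -> exists a : scalars R k, modulus a = r.
Proof.
case: k => r0; first by exists r; rewrite /= ger0_norm.
by exists (r%:C)%C; rewrite /= expr0n addr0 sqrtr_sqr ger0_norm.
Qed.

Section Seminorms.
Variables (R : realType) (k : scalar_kind) (X : tvsType (scalars R k)).
Variables (I : Type) (p : I -> X -> R).
Hypotheses (p_seminorm : forall i, is_seminorm (p i))
  (p_directed : directed_family p) (p_topology : induces_topology p).

(** Directedness is iterated along [s]; the extra index [i] provides a bound when [s] is empty and
    is the default of [nth]. *)
Lemma directed_family_bound (i : I) (s : seq I) :
  exists l, (forall x, p i x <= p l x) /\
    forall m, (m < size s)%N -> forall x, p (nth i s m) x <= p l x.
Proof.
elim: s => [|a s [l [il sl]]]; first by exists i.
have [l' [ll' al']] := p_directed l a.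
exists l'; split=> [x|[_ x|m sm x]]; [exact: le_trans (il x) _|exact: al'|].
exact: le_trans (sl m sm x) _.
Qed.

Lemma nbhs0_seminorm_ball (i : I) : nbhs 0 [set x | p i x < 1].
Proof.
apply/p_topology; exists 1%N, (fun=> i), 1; split=> // y /(_ ord0).
by rewrite subr0.
Qed.

(** By directedness the unit ball of [q] contains a ball of radius [e] of a single [p l];
    homogeneity turns this inclusion into an inequality. *)
Lemma continuous_seminorm_bound (i : I) (q : X -> R) :
    is_seminorm q -> nbhs 0 [set x | q x < 1] ->
  exists (l : I) (e : R), 0 < e /\ forall x, e * q x <= p l x.
Proof.
move=> [q0 _ qZ] /p_topology[n [s [e [e0 sq]]]].
have [l [_ sl]] := directed_family_bound i (codom s).
exists l, e; split=> // x; have [p0 _ pZ] := p_seminorm l.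
have [->|qx_neq0] := eqVneq (q x) 0; first by rewrite mulr0.
have qx0 : 0 < q x by rewrite lt0r qx_neq0 q0.
(* Rescaling by [a] gives [q (a *: x) = 1]. If [p l x < e * q x], then [a *: x] lies in all the
   balls of radius [e], which forces [q (a *: x) < 1]. *)
have [a amod] := @modulus_nneg_surj R k (q x)^-1 (ltW (eqbRL (invr_gt0 _) qx0)).
rewrite leNgt; apply/negP => pqx.
suff /sq : forall m, p (s m) (a *: x - 0) < e.
  by rewrite /= qZ amod mulVf ?ltxx.
move=> m; rewrite subr0.
have ms : s m = nth i (codom s) m.
  by rewrite codomE (nth_map m) ?nth_ord_enum// size_enum_ord.
rewrite ms; apply: le_lt_trans (sl _ _ _) _; first by rewrite size_codom card_ord.
by rewrite pZ amod mulrC ltr_pdivrMr.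
Qed.

(** The composite of [p i] with [P] is again a continuous seminorm. *)
Lemma projection_bound (i : I) (P : {linear X -> X}) : continuous P ->
  exists (l : I) (e : R), 0 < e /\ forall x, e * p i (P x) <= p l x.
Proof.
move=> Pc; have [p0 pD pZ] := p_seminorm i.
apply: (continuous_seminorm_bound i).
  by split=> [x|x y|a x] /=;
    [exact: p0|rewrite linearD; exact: pD|rewrite linearZ; exact: pZ].
have := Pc 0 [set x | p i x < 1]; rewrite linear0 => /(_ (nbhs0_seminorm_ball i)).
exact.
Qed.

End Seminorms.

Section DirectSums.
Variables (R : realType) (k : scalar_kind) (X : tvsType (scalars R k)).
Variables (M N : set X).

(** The projections are the components of the inverse [g] of the sum map: continuity comes from [g],
    linearity from uniqueness of the decomposition. *)
Lemma topological_direct_sum_projections : topological_direct_sum M N ->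
  exists P Q : {linear X -> X},
    [/\ continuous P, continuous Q, forall x, M (P x) /\ N (Q x),
        forall x, P x + Q x = x &
        forall y z, M y -> N z -> P (y + z) = y /\ Q (y + z) = z].
Proof.
move=> [[M0 ML] [N0 NL] [g [fg gf fc gc]]].
pose P x := val (g x).1; pose Q x := val (g x).2.
have PQM x : M (P x) /\ N (Q x).
  by split; apply/set_mem; [exact: (valP (g x).1)|exact: (valP (g x).2)].
have PQD x : P x + Q x = x by exact: gf.
have PQE y z : M y -> N z -> P (y + z) = y /\ Q (y + z) = z.
  move=> /mem_set My /mem_set Nz.
  have gyz : g (y + z) = (exist _ y My : M, exist _ z Nz : N).
    exact: (fg (exist _ y My : M, exist _ z Nz : N)).
  by rewrite /P /Q gyz.
have PQL a x y : P (a *: x + y) = a *: P x + P y /\ Q (a *: x + y) = a *: Q x + Q y.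
  have -> : a *: x + y = (a *: P x + P y) + (a *: Q x + Q y).
    by rewrite addrACA -scalerDr !PQD.
  by apply: PQE; apply/set_mem; [apply: ML|apply: NL];
    apply/mem_set; case: (PQM x) (PQM y) => ? ? [].
have Plin : linear P by move=> a x y; case: (PQL a x y).
have Qlin : linear Q by move=> a x y; case: (PQL a x y).
pose aP := GRing.isLinear.Build _ _ _ _ P Plin.
pose aQ := GRing.isLinear.Build _ _ _ _ Q Qlin.
pose lP : {linear X -> X} := HB.pack P aP.
pose lQ : {linear X -> X} := HB.pack Q aQ.
exists lP, lQ; split=> //= x.
- apply: (@continuous_comp _ _ _ (fun x => (g x).1) val).
    by apply: (@continuous_comp _ _ _ g fst); [exact: gc|exact: cvg_fst].
  exact: initial_continuous.
- apply: (@continuous_comp _ _ _ (fun x => (g x).2) val).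
    by apply: (@continuous_comp _ _ _ g snd) ; [exact: gc|exact: cvg_snd].
  exact: initial_continuous.
Qed.

End DirectSums.

Lemma diverges_uniformly_geometric (R : realType) (k : scalar_kind)
    (X : tvsType (scalars R k)) (f : nat -> X -> R) (A : set X) (K t : R) :
    0 < K -> 0 < t -> t < 1 -> (forall n x, A x -> K <= t ^+ n * f n x) ->
  diverges_uniformly_on f A.
Proof.
move=> K0 t0 t1 Kf C.
(* The summand 1 keeps the divisor positive even when [C] is 0. *)
have C0 : 0 < `|C| + 1 by rewrite ltr_wpDl.
have /cvgrPdist_lt /(_ (K / (`|C| + 1)) (divr_gt0 K0 C0)) : t ^+ n @[n --> \oo] --> (0 : R).
  by apply: cvg_expr; rewrite gtr0_norm.
apply: filterS => n; rewrite sub0r normrN gtr0_norm ?exprn_gt0// => tn x Ax.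
have tn0 : 0 < t ^+ n by rewrite exprn_gt0.
rewrite -(ler_pM2l tn0); apply: le_trans (Kf n x Ax).
have := ler_norm C; rewrite ltr_pdivlMr // in tn; nra.
Qed.

(** Contraction of [V] on the range of [P] means expansion of its inverse [S] there. Keeping [S],
    [V], [P] abstract serves both time directions. *)
Lemma projection_expansion (R : realType) (k : scalar_kind)
    (X : tvsType (scalars R k)) (q q' q'' : X -> R) (S V P : X -> X)
    (c t e : R) :
    0 < c -> 0 < t -> t < 1 -> 0 < e -> cancel S V ->
    (forall x, P (S x) = S (P x)) ->
    (forall x n, q (iter n V (P x)) <= c * t ^+ n * q' (P x)) ->
    (forall x, e * q' (P x) <= q'' x) ->
  diverges_uniformly_on (fun n x => q'' (iter n S x)) [set x | 1 / 2 <= q (P x)].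
Proof.
move=> c0 t0 t1 e0 SV PS qV qP.
(* With [w = iter n S (P x)], the constant comes from [1 / 2 <= c * t ^+ n * q' w] and
   [e * q' w <= q'' (iter n S x)]. *)
apply: (@diverges_uniformly_geometric _ _ _ _ _ (e / (2 * c)) t) => // [|n x /= qx].
  by rewrite divr_gt0 // mulr_gt0.
have PSn m : P (iter m S x) = iter m S (P x) by elim: m => //= m IH; rewrite PS IH.
have VS m : iter m V (iter m S (P x)) = P x.
  by elim: m => //= m IH; rewrite -iterS iterSr SV.
have := qV (iter n S x) n; rewrite PSn VS => qxn.
have := qP (iter n S x); rewrite PSn => qPn.
have tn0 : 0 < t ^+ n by rewrite exprn_gt0.
rewrite ler_pdivrMr ?mulr_gt0 //.
have : c * t ^+ n * (e * q' (iter n S (P x))) <= c * t ^+ n * q'' (iter n S x).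
  by rewrite ler_pM2l // mulr_gt0.
have : e * (1 / 2) <= e * (c * t ^+ n * q' (iter n S (P x))).
  by rewrite ler_pM2l //; exact: le_trans qxn.
nra.
Qed.

Theorem corollary37 (R : realType) (k : scalar_kind)
    (X : tvsType (scalars R k)) (X_hausdorff : hausdorff_space X)
    (I : Type) (p : I -> X -> R)
    (p_seminorm : forall i, is_seminorm (p i))
    (p_directed : directed_family p)
    (p_topology : induces_topology p)
    (T : {linear X -> X}) (Tinv : X -> X)
    (T_invertible : invertible_operator T Tinv)
    (T_hyperbolic : hyperbolic p T Tinv) :
  uniformly_topologically_expansive p T Tinv.
Proof.
case: T_invertible => _ _ TK TinvK.
case: T_hyperbolic => M [N [MN TM TN _ T_contracts]] i.
have [P [Q [Pc Qc PQM PQD PQE]]] := topological_direct_sum_projections MN.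
have [j [c [t [c0 t0 t1 TcM TcN]]]] := T_contracts i.
have PQT x : P (T x) = T (P x) /\ Q (T x) = T (Q x).
  (* [T (P x) + T (Q x)] is the decomposition of [T x], by invariance of [M] and [N]. *)
  rewrite -{1 3}(PQD x) linearD.
  by have [Mx Nx] := PQM x; apply: PQE; [apply: TM|apply: TN]; apply: imageP.
have PTinv x : P (Tinv x) = Tinv (P x).
  (* Write [x] as [T (Tinv x)] on the right and move [P] past [T]. *)
  by rewrite -[RHS](congr1 (Tinv \o P) (TinvK x)) /= (PQT _).1 TK.
have [l1 [e1 [e1_gt0 Pbnd]]] := projection_bound p_seminorm p_directed p_topology j Pc.
have [l2 [e2 [e2_gt0 Qbnd]]] := projection_bound p_seminorm p_directed p_topology j Qc.
(* Both time directions must be measured by the same seminorm. *)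
have [l [l1l l2l]] := p_directed l1 l2.
pose sphere := [set x | p i x = 1].
exists l, (sphere `&` [set x | 1 / 2 <= p i (Q x)]),
  (sphere `&` [set x | 1 / 2 <= p i (P x)]); split.
- rewrite -setIUr; apply/esym/setIidPl => x /= px1.
  have [_ pD _] := p_seminorm i; have := pD (P x) (Q x).
  rewrite PQD px1 => px.
  have [?|?] := leP (1 / 2) (p i (Q x)); [by left|right => /=; lra].
- have Qdiv := projection_expansion (q := p i) (q'' := p l) c0 t0 t1 e2_gt0 TK
    (fun x => (PQT x).2) (fun x n => TcN _ n (PQM x).2)
    (fun x => le_trans (Qbnd x) (l2l x)).
  by move=> C; apply: filterS (Qdiv C) => n Cn x [_ /Cn].
- have Pdiv := projection_expansion (q := p i) (q'' := p l) c0 t0 t1 e1_gt0 TinvK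
    PTinv (fun x n => TcM _ n (PQM x).1)
    (fun x => le_trans (Pbnd x) (l1l x)).
  by move=> C; apply: filterS (Pdiv C) => n Cn x [_ /Cn].
Qed.
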